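(* Let $\kappa>0$ and $r_\kappa=\frac{\pi}{2\sqrt\kappa}$. Let $G=(V,E)$ be a connected undirected graph with $V=\{1,\dots,N\}$, $N\ge 2$, let $(\mathcal{M},d)$ be a complete $CAT(\kappa)$ metric space, and let $X_0=(X_v(0))_{v\in V}\in\mathcal{M}^N$ be an initial configuration such that $\operatorname{diam}(\{X_v(0):v\in V\})<r_\kappa$. Let $X_k=(X_v(k))_{v\in V}$, $k\ge0$, be the sequence generated from $X_0$ by the Random Pairwise Midpoint algorithm (defined in the context). Then there exists $L<0$ such that $$\limsup_{k\to\infty}\frac{\log\mathbb{E}\,\Delta_\kappa(X_k)}{k}\le L .$$
   Context: Graph: $E$ is a set of unordered pairs $\{v,w\}$ of distinct elements of $V$; $v\sim w$ means $\{v,w\}\in E$; $\deg(v)$ is the number of neighbors of $v$. For $S\subset\mathcal{M}$, $\operatorname{diam}(S)=\sup\{d(s,s'):s,s'\in S\}$. Disagreement function: $\chi_\kappa(t)=1-\cos(\sqrt\kappa\,t)$ and, for $x=(x_1,\dots,x_N)\in\mathcal{M}^N$, $\Delta_\kappa(x)=\frac12\sum_{\{v,w\}\in E}\left(\deg(v)^{-1}+\deg(w)^{-1}\right)\chi_\kappa(d(x_v,x_w))$. Convention: $\log 0=-\infty$. $CAT(\kappa)$ space ($\kappa>0$): put $D_\kappa=\pi/\sqrt\kappa=2r_\kappa$ and let $(\mathcal{M}_\kappa^2,\bar d)$ be the unit sphere $\{x\in\mathbb{R}^3:\|x\|=1\}$ with distance $\bar d(x,y)=\kappa^{-1/2}\arccos\langle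 x,y\rangle$. A geodesic in $(\mathcal{M},d)$ is a map $c:[0,l]\to\mathcal{M}$ with $d(c(t),c(t'))=|t-t'|$ for all $t,t'\in[0,l]$; it joins $c(0)$ to $c(l)$. $(\mathcal{M},d)$ is $CAT(\kappa)$ if any two points at distance less than $D_\kappa$ are joined by a geodesic and for every geodesic triangle with vertices $p,q,r$ (three points and three geodesic segments joining them) of perimeter $d(p,q)+d(q,r)+d(r,p)<2D_\kappa$, every point $x$ on the side from $p$ to $q$ and every point $y$ on the side from $p$ to $r$, one has $d(x,y)\le\bar d(\bar x,\bar y)$, where $\bar p,\bar q,\bar r\in\mathcal{M}_\kappa^2$ is a comparison triangle (same pairwise distances as $p,q,r$), $\bar x\in[\bar p,\bar q]$ satisfies $\bar d(\bar p,\bar x)=d(p,x)$, and $\bar y\in[\bar p,\bar r]$ satisfies $\bar d(\bar p,\bar y)=d(p,y)$. In such a space two points $x,y$ with $d(x,y)<D_\kappa$ are joined by a unique geodesic and have a unique midpoint $\left\langle\frac{x+y}{2}\right\rangle$, i.e. a unique point $m$ with $d(x,m)=d(y,m)=d(x,y)/2$; closed balls of radius less than $r_\kappa$ are convex. Random Pairwise Midpoint algorithm: let $(V_k,W_k)_{k\ge 0}$ be i.i.d. random variables with values in $V\times V$ such that $\mathbb{P}[\{V_k,W_k\}=\{v,w\}]=\frac1N\left(\frac1{\deg(v)}+\frac1{\deg(w)}\right)$ if $v\sim w$ and $0$ otherwise, and such that $(V_k,W_k)$ is independent of $X_0,\dots,X_{k-1},(V_0,W_0),\dots,(V_{k-1},W_{k-1})$.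 The initial configuration $X_0$ is given (deterministic). For each $k\ge1$, set $X_{V_k}(k)=X_{W_k}(k)=\left\langle\frac{X_{V_k}(k-1)+X_{W_k}(k-1)}{2}\right\rangle$ and $X_v(k)=X_v(k-1)$ for $v\notin\{V_k,W_k\}$. (Under the diameter condition on $X_0$, all points remain at mutual distance less than $r_\kappa$, so the algorithm is well defined.) *)

(* Defs.v *)
From mathcomp Require Import all_boot all_order all_algebra.
From mathcomp Require Import all_classical all_reals all_analysis.
From mathcomp Require Import finmap.

Set Implicit Arguments.
Unset Strict Implicit.
Unset Printing Implicit Defensive.

Import Order.TTheory GRing.Theory Num.Theory.
Import numFieldNormedType.Exports.

Local Open Scope classical_set_scope.
Local Open Scope ring_scope.

Section Geodesics.
Context {R : realType} {T : Type}.
Variable dist : T -> T -> R.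

(* A geodesic is a map on [0, l]; [c] is total and its values outside [0, l]
   are junk. *)
Definition geodesic (l : R) (c : R -> T) : Prop :=
  0 <= l /\ forall t t', 0 <= t <= l -> 0 <= t' <= l ->
              dist (c t) (c t') = `|t - t'|.

Definition geodesic_from_to (l : R) (c : R -> T) (x y : T) : Prop :=
  [/\ geodesic l c, c 0 = x & c l = y].

Definition on_side (l : R) (c : R -> T) (x : T) : Prop :=
  exists2 t, 0 <= t <= l & x = c t.

Definition in_segment (x y z : T) : Prop :=
  exists l c, geodesic_from_to l c x y /\ on_side l c z.

End Geodesics.

Section ModelSphere.
Variable R : realType.

(* The library norm on row vectors is the sup norm, hence the explicit inner
   product. *)
Definition dotp (u v : 'rV[R]_3) : R := \sum_(i < 3) u 0 i * v 0 i.

Definition usphere : Type := {u : 'rV[R]_3 | dotp u u == 1}.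

Definition sphere_dist (kappa : R) (x y : usphere) : R :=
  (Num.sqrt kappa)^-1 * acos (dotp (sval x) (sval y)).

End ModelSphere.

Section CATspaces.
Context {R : realType}.

Definition D_ (kappa : R) : R := pi / Num.sqrt kappa.
Definition r_ (kappa : R) : R := pi / (2 * Num.sqrt kappa).

(* The inequality is only required for x on [p, q] and y on [p, r]; the other
   pairs of sides are covered by relabelling the vertices. *)
Definition is_CAT (kappa : R) (M : metricType R) : Prop :=
  let d := @mdist R M in
  let dbar := sphere_dist kappa in
  (forall x y : M, d x y < D_ kappa ->
     exists l c, geodesic_from_to d l c x y) /\
  (forall (p q r : M) (lpq lpr lqr : R) (cpq cpr cqr : R -> M),
     geodesic_from_to d lpq cpq p q ->
     geodesic_from_to d lpr cpr p r ->
     geodesic_from_to d lqr cqr q r ->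
     d p q + d q r + d r p < 2 * D_ kappa ->
     forall x y : M, on_side lpq cpq x -> on_side lpr cpr y ->
     forall p' q' r' : usphere R,
       dbar p' q' = d p q -> dbar q' r' = d q r -> dbar r' p' = d r p ->
     forall x' y' : usphere R,
       in_segment dbar p' q' x' -> dbar p' x' = d p x ->
       in_segment dbar p' r' y' -> dbar p' y' = d p y ->
       d x y <= dbar x' y').

Definition metric_complete (M : metricType R) : Prop :=
  forall u : nat -> M, cauchy (u @ \oo) -> exists l : M, u @ \oo --> l.

(* Extended-real valued, since the real [sup] of an unbounded set is 0. *)
Definition diam (M : metricType R) (S : set M) : \bar R :=
  ereal_sup [set (mdist s s')%:E | s in S & s' in S].

(* [x] is a default value, taken only when no midpoint exists. *)
Definition midpoint (M : metricType R) (x y : M) : M :=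
  xget x [set m : M | mdist x m = mdist x y / 2 /\ mdist y m = mdist x y / 2].

End CATspaces.

Section Disagreement.
Context {R : realType} {N : nat}.
Variable E : rel 'I_N.

Definition deg (v : 'I_N) : nat := #|[pred w | E v w]|.

Definition chi (kappa t : R) : R := 1 - cos (Num.sqrt kappa * t).

(* Each unordered edge {v, w} is counted once, with v < w. *)
Definition Delta (kappa : R) (M : metricType R) (x : 'I_N -> M) : R :=
  2^-1 * \sum_(v < N) \sum_(w < N | (v < w)%N && E v w)
           ((deg v)%:R^-1 + (deg w)%:R^-1) * chi kappa (mdist (x v) (x w)).

End Disagreement.

Section RandomPairwiseMidpoint.
Context {R : realType} {N : nat}.

(* Step k.+1 uses the pair of index k.+1; the pair of index 0 is unused. *)
Fixpoint rpm (M : metricType R) (X0 : 'I_N -> M) (vw : nat -> 'I_N * 'I_N)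
    (k : nat) : 'I_N -> M :=
  if k is k'.+1 then
    let X := rpm X0 vw k' in
    let: (v, w) := vw k in
    fun u => if (u == v) || (u == w) then midpoint (X v) (X w) else X u
  else X0.

Context {d : measure_display} {Omega : measurableType d}.
Variable P : probability Omega R.

(* The finite type A carries its discrete sigma-algebra. *)
Definition iid_discrete (A : finType) (Y : nat -> Omega -> A) : Prop :=
  [/\ forall k (B : set A), measurable (Y k @^-1` B),
      forall (J : {fset nat}) (B : nat -> set A),
        P (\bigcap_(k in [set` J]) (Y k @^-1` B k)) =
        (\prod_(k <- J) P (Y k @^-1` B k))%E
    & forall k (B : set A), P (Y k @^-1` B) = P (Y 0%N @^-1` B)].

(* [set a; b] is the unordered pair {a, b}. *)
Definition edge_law (E : rel 'I_N) (VW : Omega -> 'I_N * 'I_N) : Prop :=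
  forall v w : 'I_N,
    P [set o | [set (VW o).1; (VW o).2] = [set v; w]] =
    (if E v w then N%:R^-1 * ((deg E v)%:R^-1 + (deg E w)%:R^-1) else 0)%:E.

End RandomPairwiseMidpoint.

(* Main.v *)
(* Write chi_vw = 1 - cos (sqrt kappa * d (x_v, x_w)) and let W be the sum of
   chi_vw over all ordered pairs, adjacent or not.  Comparison with the sphere
   gives, for the midpoint m of x and y,
     cos |zx| + cos |zy| <= 2 cos (|xy| / 2) cos |zm|,
   so averaging along an edge {v, w} does not increase the total chi from any
   other vertex to v and w, while chi_vw itself drops to 0: W decreases by at
   least 2 chi_vw.  Since chi_uw <= 2 chi_uv + 2 chi_vw, connectedness bounds W
   by a constant times the expected value of chi on the random edge.  Hence one
   step multiplies E W by at most some rho < 1, and Delta <= W. *)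
Require Import Defs.
From mathcomp Require Import all_boot all_order all_algebra.
From mathcomp Require Import all_classical all_reals all_analysis.
From mathcomp Require Import measurable_realfun finmap ring lra.

Set Implicit Arguments.
Unset Strict Implicit.
Unset Printing Implicit Defensive.

Import Order.TTheory GRing.Theory Num.Theory.
Import numFieldNormedType.Exports.

Local Open Scope classical_set_scope.
Local Open Scope ring_scope.

(** * Polar coordinates and comparison triangles on the unit sphere *)

Section Sphere.
Variable R : realType.
Implicit Types (phi psi s t u : R).

(** Polar coordinates about the pole (1, 0, 0): longitude [phi], angular distance [t] from the pole.
    For fixed [phi], [t] traces a meridian at unit speed. *)
Definition spherical phi t : 'rV[R]_3 :=
  \row_i [:: cos t; cos phi * sin t; sin phi * sin t]`_i.

Lemma dotp_spherical phi psi t u :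
  dotp (spherical phi t) (spherical psi u) =
  cos t * cos u + cos (phi - psi) * (sin t * sin u).
Proof.
by rewrite /dotp !big_ord_recl big_ord0 !mxE /= cosB; ring.
Qed.

Lemma dotp_spherical_same phi t u :
  dotp (spherical phi t) (spherical phi u) = cos (t - u).
Proof. by rewrite dotp_spherical subrr cos0 mul1r -cosB. Qed.

Lemma spherical_unit phi t : dotp (spherical phi t) (spherical phi t) == 1.
Proof. by rewrite dotp_spherical_same subrr cos0. Qed.

Definition sph_pt phi t : usphere R :=
  exist (fun v => dotp v v == 1) _ (spherical_unit phi t).

Lemma sph_pt_north phi psi : sph_pt phi 0 = sph_pt psi 0.
Proof.
apply: val_inj => /=; apply/rowP => i.
by rewrite !mxE sin0 !mulr0.
Qed.

Lemma cos_normr t : cos `|t| = cos t.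
Proof. by case: (ger0P t) => // _; rewrite cosN. Qed.

Lemma le_cos t u : 0 <= t -> t <= u -> u <= pi -> cos u <= cos t.
Proof.
move=> t0 tu upi.
have tI : t \in `[0, pi] by rewrite in_itv /= t0 (le_trans tu).
have uI : u \in `[0, pi] by rewrite in_itv /= upi (le_trans t0).
by rewrite leNgt ltr_cos // -leNgt.
Qed.

Lemma acos_cos_dist t u : `|t - u| <= pi -> acos (cos (t - u)) = `|t - u|.
Proof.
move=> tu; by rewrite -cos_normr cosK // in_itv /= normr_ge0.
Qed.

Lemma sphere_dist_meridian kappa phi t u : `|t - u| <= pi ->
  sphere_dist kappa (sph_pt phi t) (sph_pt phi u) =
  (Num.sqrt kappa)^-1 * `|t - u|.
Proof.
by move=> tu; rewrite /sphere_dist /= dotp_spherical_same acos_cos_dist.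
Qed.

Lemma meridian_geodesic kappa phi l : 0 < kappa -> 0 <= l ->
  Num.sqrt kappa * l <= pi ->
  geodesic (sphere_dist kappa) l (fun t => sph_pt phi (Num.sqrt kappa * t)).
Proof.
move=> k0 l0 lpi; split => // t u /andP[t0 tl] /andP[u0 ul].
have s0 : 0 < Num.sqrt kappa by rewrite sqrtr_gt0.
rewrite sphere_dist_meridian -mulrBr normrM (gtr0_norm s0) ?mulKf ?gt_eqF //.
apply: le_trans lpi; rewrite ler_pM2l // ler_norml; apply/andP; split; lra.
Qed.

Lemma meridian_segment kappa phi l t : 0 < kappa -> 0 <= t <= l ->
  Num.sqrt kappa * l <= pi ->
  in_segment (sphere_dist kappa) (sph_pt 0 0) (sph_pt phi (Num.sqrt kappa * l))
    (sph_pt phi (Num.sqrt kappa * t)).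
Proof.
move=> k0 tl lpi; exists l, (fun t => sph_pt phi (Num.sqrt kappa * t)); split.
  split => //; last by rewrite mulr0; exact: sph_pt_north.
  by apply: meridian_geodesic => //; case/andP: tl => [t0 /(le_trans t0)].
by exists t.
Qed.

(* Spherical law of cosines: the angle opposite to a side [c] of a triangle
   with sides [a], [b], [c] exists by the triangle inequality.  The degenerate
   case [sin a * sin b = 0] is covered, division by 0 giving 0. *)
Lemma comparison_angle (a b c : R) : 0 <= a -> 0 <= b -> a + b <= pi ->
  `|a - b| <= c -> c <= a + b ->
  exists phi, cos c = cos a * cos b + cos phi * (sin a * sin b).
Proof.
move=> a0 b0 abpi abc cab.
have c0 : 0 <= c by exact: le_trans abc.
have cpi : c <= pi by exact: le_trans abpi.
have lo : cos (a + b) <= cos c by exact: le_cos.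
have hi : cos c <= cos (a - b) by rewrite -(cos_normr (a - b)) le_cos.
move: lo hi; rewrite cosD cosB => lo hi.
(* [g] is the candidate for [cos phi]; [lo] and [hi] bound it by -1 and 1. *)
set g := (cos c - cos a * cos b) / (sin a * sin b).
have sa : 0 <= sin a by apply: sin_ge0_pi; rewrite a0; lra.
have sb : 0 <= sin b by apply: sin_ge0_pi; rewrite b0; lra.
have gE : g * (sin a * sin b) = cos c - cos a * cos b.
  (* If the product vanishes, [lo] and [hi] force cos c = cos a cos b. *)
  have [s0|s0] := eqVneq (sin a * sin b) 0; last by rewrite divfK.
  by rewrite s0 mulr0; lra.
have gB : -1 <= g <= 1.
  have [s0|s0] := eqVneq (sin a * sin b) 0.
    by rewrite /g s0 invr0 mulr0 oppr_le0 ler01.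
  have sp : 0 < sin a * sin b by rewrite lt_def s0 mulr_ge0.
  by rewrite /g ler_pdivlMr // ler_pdivrMr //; apply/andP; split; lra.
by exists (acos g); rewrite acosK ?in_itv //= gE; lra.
Qed.

End Sphere.

(** * Midpoint inequalities in a CAT(kappa) space *)

Section CatMidpoint.
Variables (R : realType) (kappa : R) (M : metricType R).
Hypotheses (kappa_gt0 : 0 < kappa) (M_CAT : is_CAT kappa M).
Local Notation d := (@mdist R M).
Local Notation s := (Num.sqrt kappa).
Implicit Types x y z m : M.

(** Scaling by sqrt kappa turns comparison distances into angles on the unit sphere and r_kappa into
    pi / 2. *)
Definition ang x y : R := s * d x y.
Definition near_pts x y := ang x y < pi / 2.

Let s_gt0 : 0 < s. Proof. by rewrite sqrtr_gt0. Qed.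

Lemma near_ptsE x y : near_pts x y = (d x y < r_ kappa).
Proof.
have -> : r_ kappa = pi / 2 / s by rewrite /r_ invfM mulrA.
by rewrite ltr_pdivlMr // mulrC.
Qed.

Lemma ang_ge0 x y : 0 <= ang x y.
Proof. by rewrite mulr_ge0 ?sqrtr_ge0 // mdist_ge0. Qed.

Lemma ang_sym x y : ang x y = ang y x.
Proof. by rewrite /ang metric_sym. Qed.

Lemma ang_triangle x y z : ang x z <= ang x y + ang y z.
Proof. by rewrite /ang -mulrDr ler_pM2l // metric_triangle. Qed.

Lemma ang_xx x : ang x x = 0.
Proof. by rewrite /ang mdistxx mulr0. Qed.

Lemma cos_ang_ge0 x y : near_pts x y -> 0 <= cos (ang x y).
Proof.
move=> xy; apply: cos_ge0_pihalf; rewrite (ltW xy) andbT.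
by rewrite (le_trans _ (ang_ge0 x y)) // oppr_le0 divr_ge0 // pi_ge0.
Qed.

Lemma near_lt_D x y : near_pts x y -> d x y < D_ kappa.
Proof.
move=> xy; rewrite /D_ ltr_pdivlMr // mulrC; apply: lt_trans xy _.
by rewrite ltr_pdivrMr // mulr_natr mulr2n ltrDl pi_gt0.
Qed.

Lemma geodesic_length l c x y : geodesic_from_to d l c x y -> l = d x y.
Proof.
move=> [[l0 c_geo] <- <-].
by rewrite c_geo ?lexx ?l0 // sub0r normrN ger0_norm.
Qed.

(** On the sphere this is an equality, the spherical median formula. The CAT condition makes the
    true median no longer than the spherical one, and cos is decreasing on [0, pi]. The comparison
    triangle has x at the pole, y on meridian 0 and z on meridian [phi]. *)
Lemma cat_median l c x y z : geodesic_from_to d l c x y ->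
  near_pts x y -> near_pts x z -> near_pts y z ->
  cos (ang x z) + cos (ang y z) <=
    2 * cos (ang x y / 2) * cos (ang z (c (l / 2))).
Proof.
move=> gxy xy xz yz; have lE := geodesic_length gxy.
have pi0 : 0 < pi :> R := pi_gt0 R.
have [M_geo M_cmp] := M_CAT.
have [lxz [cxz gxz]] := M_geo _ _ (near_lt_D xz).
have [lyz [cyz gyz]] := M_geo _ _ (near_lt_D yz).
have lxzE := geodesic_length gxz.
have lyzE := geodesic_length gyz.
set a := ang x y; set b := ang x z; set e := ang y z.
have [a0 b0 e0] : [/\ 0 <= a, 0 <= b & 0 <= e] by rewrite !ang_ge0.
rewrite /near_pts -/a in xy; rewrite /near_pts -/b in xz.
rewrite /near_pts -/e in yz.
have [phi phiE] : exists phi, cos e = cos a * cos b + cos phi * (sin a * sin b).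
  apply: comparison_angle => //; first lra; last first.
    by rewrite /e (le_trans (ang_triangle y x z)) // ang_sym.
  have := ang_triangle x z y; have := ang_triangle x y z.
  rewrite -/a -/b -/e (ang_sym z y) -/e => t1 t2.
  by rewrite ler_norml; apply/andP; split; lra.
have l0 : 0 <= l by case: gxy => -[].
(* [D] is the cosine of the median of the comparison triangle. *)
set D := dotp (sval (sph_pt 0 (s * (l / 2)))) (sval (sph_pt phi b)).
have aE : s * (l / 2) = a / 2 by rewrite /a /ang lE mulrA.
have DE : D = cos (a / 2) * cos b + cos phi * (sin (a / 2) * sin b).
  by rewrite /D /= dotp_spherical aE sub0r cosN.
have D2 : 2 * cos (a / 2) * D = cos b + cos e.
  have -> : cos e = cos (a / 2 + a / 2) * cos b
                  + cos phi * (sin (a / 2 + a / 2) * sin b).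
    by rewrite -splitr.
  have bE : cos b = (cos (a / 2) ^+ 2 + sin (a / 2) ^+ 2) * cos b.
    by rewrite cos2Dsin2 mul1r.
  by rewrite cosD sinD DE [X in _ = X + _]bE; ring.
(* [D] lies between cos (a / 2 + b) and cos (a / 2 - b) because |cos phi| <= 1. *)
have Db : -1 <= D <= 1.
  have ch := cos_max phi; rewrite ler_norml in ch; case/andP: ch => ch1 ch2.
  have sa : 0 <= sin (a / 2) by apply: sin_ge0_pi; apply/andP; split; lra.
  have sb : 0 <= sin b by apply: sin_ge0_pi; apply/andP; split; lra.
  have sp := mulr_ge0 sa sb.
  have := cos_geN1 (a / 2 + b); have := cos_le1 (a / 2 - b).
  rewrite cosB cosD DE => h1 h2; apply/andP; split; nra.
have cmp : d (c (l / 2)) z <=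
    sphere_dist kappa (sph_pt 0 (s * (l / 2))) (sph_pt phi b).
  have lpi : s * l <= pi by rewrite lE -/(ang x y) -/a; lra.
  have bpi : s * lxz <= pi by rewrite lxzE -/(ang x z) -/b; lra.
  have bE : b = s * lxz by rewrite lxzE.
  have dE : forall psi t, 0 <= t -> s * t <= pi ->
      sphere_dist kappa (sph_pt 0 0) (sph_pt psi (s * t)) = t.
    move=> psi t t0 tpi; rewrite (sph_pt_north 0 psi).
    rewrite sphere_dist_meridian sub0r normrN.
      by rewrite ger0_norm ?mulr_ge0 ?sqrtr_ge0 // mulKf // gt_eqF.
    by rewrite ger0_norm // mulr_ge0 // sqrtr_ge0.
  have lxz0 : 0 <= lxz by rewrite lxzE mdist_ge0.
  (* The point taken on the side from x to z is its endpoint z. *)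
  apply: (M_cmp x y z l lxz lyz c cxz cyz gxy gxz gyz _ _ _ _ _
            (sph_pt 0 0) (sph_pt 0 (s * l)) (sph_pt phi b)).
  - rewrite /D_ mulrA ltr_pdivlMr //.
    have -> : (d x y + d y z + d z x) * s = a + e + b.
      by rewrite /a /e /b /ang (metric_sym z x); ring.
    lra.
  - by exists (l / 2) => //; apply/andP; split; lra.
  - exists lxz; first by rewrite lxz0 lexx.
    by case: gxz.
  - by rewrite dE.
  - rewrite /sphere_dist /= dotp_spherical sub0r cosN lE -/(ang x y) -/a -phiE.
    rewrite cosK ?in_itv /= ?e0 /=; last lra.
    by rewrite /e /ang mulKf // gt_eqF.
  - rewrite /sphere_dist /= dotp_spherical sin0 cos0 !mulr0 addr0 mulr1.
    rewrite cosK ?in_itv /= ?b0 /=; last lra.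
    by rewrite /b /ang mulKf ?gt_eqF // metric_sym.
  - by apply: meridian_segment => //; apply/andP; split; lra.
  - rewrite dE //; [|lra|rewrite aE; lra].
    case: gxy => -[_ c_geo] <- _; rewrite c_geo ?lexx ?l0 //; last first.
      by apply/andP; split; lra.
    by rewrite sub0r normrN ger0_norm //; lra.
  - by rewrite bE; apply: meridian_segment => //; rewrite lxz0 lexx.
  - by rewrite bE dE.
have cosD_le : D <= cos (ang z (c (l / 2))).
  have h : ang z (c (l / 2)) <= acos D.
    move: cmp; rewrite /sphere_dist -/D ler_pdivlMl //.
    by rewrite /ang metric_sym.
  rewrite -[leLHS]acosK ?in_itv //=.
  by apply: le_cos => //; [exact: ang_ge0|exact: acos_lepi].
rewrite -D2 ler_wpM2l // mulr_ge0 //.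
apply: cos_ge0_pihalf; apply/andP; split; lra.
Qed.


Lemma midpointP x y : near_pts x y ->
  d x (midpoint x y) = d x y / 2 /\ d y (midpoint x y) = d x y / 2.
Proof.
move=> xy; rewrite /midpoint; case: xgetP => [m _ []//|no_mid].
(* The default value of [midpoint] is excluded, since the centre of a geodesic is a midpoint. *)
have [l [c gxy]] := M_CAT.1 _ _ (near_lt_D xy).
have lE := geodesic_length gxy.
have l0 : 0 <= l by rewrite lE mdist_ge0.
case: (no_mid (c (l / 2))); rewrite -lE; case: gxy => -[_ c_geo] <- <-.
have hI : 0 <= l / 2 <= l by apply/andP; split; lra.
split; rewrite c_geo ?lexx ?l0 // ?sub0r ?normrN ger0_norm; lra.
Qed.

Lemma ang_midpoint x y : near_pts x y ->
  ang x (midpoint x y) = ang x y / 2 /\ ang y (midpoint x y) = ang x y / 2.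
Proof. by move=> /midpointP[xm ym]; rewrite /ang xm ym mulrA. Qed.

(* [midpoint x y] is an arbitrary midpoint a priori; applying [cat_median] to
   [z = midpoint x y] itself shows that its distance to [c (l / 2)] is 0. *)
Lemma midpoint_geodesic l c x y : geodesic_from_to d l c x y ->
  near_pts x y -> midpoint x y = c (l / 2).
Proof.
move=> gxy xy; have [xm ym] := ang_midpoint xy.
have a0 := ang_ge0 x y; move: (xy); rewrite /near_pts => api.
set m := midpoint x y in xm ym *.
have near_m t : ang t m = ang x y / 2 -> near_pts t m.
  by rewrite /near_pts => ->; lra.
have := cat_median gxy xy (near_m _ xm) (near_m _ ym).
rewrite xm ym => h.
(* Dividing [h] by this positive cosine leaves cos (ang m (c (l / 2))) >= 1. *)
have ch : 0 < cos (ang x y / 2).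
  by apply: cos_gt0_pihalf; apply/andP; split; lra.
have c1 : cos 0 <= cos (ang m (c (l / 2))) by rewrite cos0; nra.
apply: mdist_positivity; apply: (mulfI (lt0r_neq0 s_gt0)); rewrite mulr0.
have pi0 := pi_gt0 R.
(* A cosine of 1 forces the angle to be 0 only within a range such as [0, pi]. *)
have mc : ang m (c (l / 2)) <= pi.
  have := ang_triangle m x (c (l / 2)); rewrite (ang_sym m x) xm.
  have -> : ang x (c (l / 2)) = ang x y / 2.
    have lE := geodesic_length gxy; have l0 : 0 <= l by rewrite lE mdist_ge0.
    rewrite /ang -mulrA -lE; case: gxy => -[_ c_geo] <- _; congr (s * _).
    have hI : 0 <= l / 2 <= l by apply/andP; split; lra.
    by rewrite c_geo ?lexx ?l0 // ?sub0r ?normrN ger0_norm; lra.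
  lra.
apply/eqP; rewrite eq_le ang_ge0 andbT leNgt; apply/negP => gt0.
by move: c1; rewrite leNgt ltr_cos ?gt0 // in_itv /= ?lexx ?ang_ge0 ?mc ?pi_ge0.
Qed.

Lemma midpoint_median x y z :
  near_pts x y -> near_pts x z -> near_pts y z ->
  cos (ang x z) + cos (ang y z) <=
    2 * cos (ang x y / 2) * cos (ang z (midpoint x y)).
Proof.
move=> xy xz yz; have [l [c gxy]] := M_CAT.1 _ _ (near_lt_D xy).
by rewrite (midpoint_geodesic gxy xy); apply: cat_median gxy xy xz yz.
Qed.

(** The median inequality makes the cosine of the angle from z to the midpoint positive. By the
    triangle inequality that angle is below pi / 2 + pi / 4, so positivity puts it below pi / 2. *)
Lemma midpoint_near x y z :
  near_pts x y -> near_pts x z -> near_pts y z -> near_pts z (midpoint x y).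
Proof.
move=> xy xz yz; have h := midpoint_median xy xz yz.
have cos_gt0 t : near_pts t z -> 0 < cos (ang t z).
  move=> tz; apply: cos_gt0_pihalf; rewrite [_ < pi / 2]tz andbT.
  by have := pi_gt0 R; have := ang_ge0 t z; lra.
have := cos_gt0 _ xz; have := cos_gt0 _ yz => yz0 xz0.
have ch : 0 <= cos (ang x y / 2).
  move: xy; have := ang_ge0 x y; rewrite /near_pts => a0 api.
  by apply: cos_ge0_pihalf; apply/andP; split; lra.
rewrite /near_pts ltNge; apply/negP => far.
have : cos (ang z (midpoint x y)) <= cos (pi / 2).
  apply: le_cos => //; first by rewrite divr_ge0 ?pi_ge0.
  have := ang_triangle z x (midpoint x y); rewrite (ang_midpoint xy).1.
  by move: xy xz; rewrite /near_pts (ang_sym x z); lra.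
by rewrite cos_pihalf; nra.
Qed.

(** The factor cos (ang x y / 2) <= 1 may be dropped from the median inequality because
    [midpoint_near] makes the other cosine nonnegative. *)
Lemma chi_midpoint x y z :
  near_pts x y -> near_pts x z -> near_pts y z ->
  2 * chi kappa (d z (midpoint x y)) <= chi kappa (d z x) + chi kappa (d z y).
Proof.
move=> xy xz yz; have h := midpoint_median xy xz yz.
have zm := cos_ang_ge0 (midpoint_near xy xz yz).
rewrite /chi -/(ang z x) -/(ang z y) -/(ang z (midpoint x y)).
rewrite (ang_sym z x) (ang_sym z y).
have := cos_le1 (ang x y / 2); nra.
Qed.

Lemma midpointxx x : midpoint x x = x.
Proof.
have xx : near_pts x x by rewrite /near_pts ang_xx divr_gt0 ?pi_gt0.
apply/esym/mdist_positivity.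
by have [-> _] := midpointP xx; rewrite mdistxx mul0r.
Qed.

Lemma chi_ge0 t : 0 <= chi kappa t.
Proof. by rewrite subr_ge0 cos_le1. Qed.

Lemma chi_xx x : chi kappa (d x x) = 0.
Proof. by rewrite /chi -/(ang x x) ang_xx cos0 subrr. Qed.

(** With chi = 2 sin^2 of the half angle, this is (p q + u v)^2 <= 2 p^2 + 2 v^2 for the terms of
    sin (alpha + beta). Nearness keeps the sum of the angles in the range where cos decreases. *)
Lemma chi_quasi_triangle x y z : near_pts x y -> near_pts y z ->
  chi kappa (d x z) <= 2 * chi kappa (d x y) + 2 * chi kappa (d y z).
Proof.
rewrite /near_pts => xy yz; rewrite /chi -!/(ang _ _).
have h : cos (ang x y + ang y z) <= cos (ang x z).
  by apply: le_cos; rewrite ?ang_ge0 ?ang_triangle //; lra.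
have hE (t : R) : cos t = 1 - 2 * sin (t / 2) ^+ 2.
  rewrite [in LHS](splitr t) cosD -!expr2 cos2sin2; ring.
rewrite (hE (ang x y)) (hE (ang y z)).
move: h; rewrite (hE (_ + _)) (mulrDl (ang x y)) sinD.
set p := sin _; set q := cos _; set u := cos _; set v := sin _.
have p2 : u ^+ 2 = 1 - p ^+ 2 by exact: cos2sin2.
have v2 : q ^+ 2 = 1 - v ^+ 2 by exact: cos2sin2.
have := sqr_ge0 (p * q - u * v); have := sqr_ge0 (p * v).
nra.
Qed.

End CatMidpoint.

(** * Decrease of the energy of a configuration *)

Section Configurations.
Variables (R : realType) (kappa : R) (M : metricType R) (N : nat).
Variable E : rel 'I_N.
Hypotheses (kappa_gt0 : 0 < kappa) (M_CAT : is_CAT kappa M).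
Local Notation chid p q := (chi kappa (mdist p q)).
Implicit Types (x : 'I_N -> M) (a : 'I_N * 'I_N).

Definition step x a : 'I_N -> M :=
  fun u => if (u == a.1) || (u == a.2) then midpoint (x a.1) (x a.2) else x u.

(** The diameter condition in pairwise form, the invariant of the algorithm. *)
Definition clustered x := forall u t, near_pts kappa (x u) (x t).

(** This is the W of the overview. A vertex outside the chosen edge is compared with both ends, even
    if adjacent to only one, hence the sum over all pairs. *)
Definition energy x : R := \sum_u \sum_t chid (x u) (x t).

Lemma energy_ge0 x : 0 <= energy x.
Proof. by apply: sumr_ge0 => u _; apply: sumr_ge0 => t _; exact: chi_ge0. Qed.

Lemma step_clustered x a : clustered x -> clustered (step x a).
Proof.
move=> cx u t.
have near_mid z : near_pts kappa (x z) (midpoint (x a.1) (x a.2)).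
  exact: midpoint_near.
rewrite /step; case: ifP => _; case: ifP => _ //.
- by rewrite /near_pts ang_xx divr_gt0 ?pi_gt0.
- by rewrite /near_pts ang_sym; exact: near_mid.
Qed.

Lemma energy_step x a : clustered x ->
  energy (step x a) + 2 * chid (x a.1) (x a.2) <= energy x.
Proof.
(* The bound is for every pair of vertices; when v = w nothing moves. *)
case: a => v w cx /=; have [<-|vw] := eqVneq v w.
  rewrite chi_xx mulr0 addr0 le_eqVlt; apply/orP; left; apply/eqP.
  congr energy; apply/funext => u; rewrite /step /= orbb.
  by case: eqP => // ->; exact: (midpointxx kappa_gt0 M_CAT).
set y := step x (v, w); set m := midpoint (x v) (x w).
have split2 (F : 'I_N -> R) :
    \sum_u F u = F v + F w + \sum_(u | (u != v) && (u != w)) F u.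
  by rewrite (bigD1 v) //= (bigD1 w) 1?eq_sym //= addrA.
have yv : y v = m by rewrite /y /step eqxx.
have yw : y w = m by rewrite /y /step eqxx orbT.
have yE u : (u != v) && (u != w) -> y u = x u.
  by rewrite /y /step /= => /andP[/negbTE-> /negbTE->].
have mid u : 2 * chid (x u) m <= chid (x u) (x v) + chid (x u) (x w).
  exact: chi_midpoint.
have chi_sym (p q : M) : chid p q = chid q p by rewrite metric_sym.
(* After the step, rows v and w both equal [A]; in every other row the entries v and w are averaged
   by [mid]. *)
pose A := \sum_(t | (t != v) && (t != w)) chid m (x t).
have rowm : \sum_t chid m (y t) = A.
  rewrite split2 yv yw chi_xx !add0r; apply: eq_bigr => t Pt.
  by rewrite yE.
have rowu u : (u != v) && (u != w) ->
    \sum_t chid (y u) (y t) <= \sum_t chid (x u) (x t).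
  move=> Pu; rewrite !split2 yv yw yE //; apply: lerD.
    by have := mid u; lra.
  by apply: ler_sum => t Pt; rewrite yE.
(* The gain is 2 chi_vw because chi_vw stands once in row v and once in row w. *)
have rowvw : 2 * A + 2 * chid (x v) (x w) <=
    \sum_t chid (x v) (x t) + \sum_t chid (x w) (x t).
  rewrite !split2 !chi_xx (chi_sym (x w) (x v)).
  suff : 2 * A <= \sum_(t | (t != v) && (t != w)) chid (x v) (x t)
                + \sum_(t | (t != v) && (t != w)) chid (x w) (x t) by lra.
  rewrite /A mulr_sumr -big_split /=; apply: ler_sum => t Pt.
  by rewrite !(chi_sym _ (x t)).
rewrite /energy (split2 (fun u => \sum_t chid (y u) (y t))).
rewrite (split2 (fun u => \sum_t chid (x u) (x t))) yv yw rowm.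
have : \sum_(u | (u != v) && (u != w)) \sum_t chid (y u) (y t) <=
    \sum_(u | (u != v) && (u != w)) \sum_t chid (x u) (x t).
  exact: ler_sum.
move: rowvw; lra.
Qed.

(** Each further edge costs one quasi-triangle inequality, and 2 S + 2 * 4^n S <= 4^(n+1) S. *)
Lemma chi_path x S u p : clustered x -> 0 <= S ->
  (forall v w, E v w -> chid (x v) (x w) <= S) ->
  path E u p -> chid (x u) (x (last u p)) <= 4 ^+ size p * S.
Proof.
move=> cx S0 edgeS; elim: p u => [|v p IHp] u /=.
  by rewrite chi_xx mul1r.
move=> /andP[/edgeS uv /IHp vp].
apply: le_trans (chi_quasi_triangle kappa_gt0 (cx u v) (cx v _)) _.
have e1 : 1 <= 4 ^+ size p :> R by rewrite exprn_ege1 // ler1n.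
rewrite exprS; nra.
Qed.

Lemma energy_le_edges x S : clustered x -> 0 <= S ->
  (forall u t, connect E u t) ->
  (forall v w, E v w -> chid (x v) (x w) <= S) ->
  energy x <= N%:R ^+ 2 * 4 ^+ N * S.
Proof.
move=> cx S0 conn edgeS.
have pair u t : chid (x u) (x t) <= 4 ^+ N * S.
  have /connectP[p pathp ->] := conn u t.
  (* A path without repeated vertices has fewer than N edges. *)
  case: (shortenP pathp) => q pathq uniq_q _.
  apply: le_trans (chi_path cx S0 edgeS pathq) _.
  rewrite ler_wpM2r // ler_weXn2l ?ler1n //.
  have := max_card (mem (u :: q)); rewrite card_ord (card_uniqP uniq_q) /=.
  exact: ltnW.
apply: le_trans (_ : \sum_(u < N) \sum_(t < N) 4 ^+ N * S <= _).
  by apply: ler_sum => u _; apply: ler_sum => t _; exact: pair.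
by rewrite !sumr_const card_ord -mulrnA -(mulr_natl (_ * S)) natrM -expr2 mulrA.
Qed.

(** Two inverse degrees sum to at most 2, which the factor 1/2 offsets; the remaining terms of the
    energy are nonnegative. *)
Lemma Delta_le_energy x : Delta E kappa x <= energy x.
Proof.
rewrite /Delta /energy ler_pdivrMl // mulr_sumr; apply: ler_sum => v _.
rewrite mulr_sumr big_mkcond; apply: ler_sum => w _ /=.
have c0 := chi_ge0 kappa (mdist (x v) (x w)).
have inv_le1 n : n%:R^-1 <= 1 :> R.
  by case: n => [|n]; rewrite ?invr0 // invf_le1 ?ler1n ?ltr0n.
case: ifP => _; last by rewrite mulr_ge0.
by rewrite ler_wpM2r // (_ : 2 = 1 + 1) // lerD.
Qed.

Lemma Delta_ge0 x : 0 <= Delta E kappa x.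
Proof.
rewrite mulr_ge0 // sumr_ge0 // => v _; apply: sumr_ge0 => w _.
by rewrite mulr_ge0 ?chi_ge0 // addr_ge0 // invr_ge0.
Qed.

(* [mu] is the law of the ordered pair; only the mass of unordered edges is
   known, hence the symmetrised lower bound. *)
Lemma energy_contraction (c : R) (mu : 'I_N * 'I_N -> R) : (0 < N)%N -> 0 < c ->
  (forall u t, connect E u t) ->
  (forall a, 0 <= mu a) -> \sum_a mu a = 1 ->
  irreflexive E ->
  (forall v w, E v w -> c <= mu (v, w) + mu (w, v)) ->
  exists2 rho, 0 < rho < 1 & forall x, clustered x ->
    \sum_a mu a * energy (step x a) <= rho * energy x.
Proof.
move=> N0 c0 conn mu0 mu1 irrE muE.
(* With [S] below, the mean of chi on the random pair, every edge has chi <= S / c, so the energy is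
   at most K * S. The mean drop 2 * S is then at least energy / (K + 1); the added 1 makes the rate
   positive. *)
pose K := N%:R ^+ 2 * 4 ^+ N / c : R.
have K0 : 0 < K by rewrite divr_gt0 // mulr_gt0 // exprn_gt0 // ltr0n.
have K1 : 0 < K + 1 by lra.
exists (1 - (K + 1)^-1).
  by rewrite subr_gt0 gtrBl invr_gt0 K1 andbT invf_lt1 //; lra.
move=> x cx; pose S := \sum_a mu a * chid (x a.1) (x a.2).
have S0 : 0 <= S by apply: sumr_ge0 => a _; rewrite mulr_ge0 ?chi_ge0.
have edgeS v w : E v w -> chid (x v) (x w) <= S / c.
  (* Both orientations of the edge contribute the same chi to [S]; they are distinct terms since E
     is irreflexive. *)
  move=> vw; rewrite ler_pdivlMr // /S (bigD1 (v, w)) //= (bigD1 (w, v)) /=.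
    have rest : 0 <= \sum_(i | (i != (v, w)) && (i != (w, v)))
                       mu i * chid (x i.1) (x i.2).
      by apply: sumr_ge0 => a _; rewrite mulr_ge0 ?chi_ge0.
    rewrite (metric_sym (x w)) addrA -mulrDl.
    have := chi_ge0 kappa (mdist (x v) (x w)); have := muE _ _ vw; nra.
  by apply/eqP => -[wv _]; rewrite wv irrE in vw.
have Sc0 : 0 <= S / c by rewrite divr_ge0 // ltW.
have eK : energy x <= K * S.
  apply: le_trans (energy_le_edges cx Sc0 conn edgeS) _.
  by rewrite /K mulrA [X in X <= _]mulrAC.
have drop : \sum_a mu a * energy (step x a) <= energy x - 2 * S.
  apply: le_trans (_ : \sum_a (mu a * energy x -
                         2 * (mu a * chid (x a.1) (x a.2))) <= _).
    apply: ler_sum => a _; have := energy_step a cx; have := mu0 a; nra.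
  by rewrite sumrB -mulr_suml mu1 mul1r -mulr_sumr.
apply: le_trans drop _; rewrite mulrBl mul1r lerD2l lerN2.
by rewrite ler_pdivrMl //; have := mulr_ge0 (ltW K0) S0; lra.
Qed.

End Configurations.

Arguments energy {R} kappa {M N} x.

(** * Expectations of functions of finitely valued random variables *)

Section FiniteRandomVariables.
Variables (R : realType) (d : measure_display) (Omega : measurableType d).
Variable P : probability Omega R.

Definition pr (A : set Omega) : R := fine (P A).

Lemma prE (A : set Omega) : measurable A -> P A = (pr A)%:E.
Proof. by move=> mA; rewrite fineK // fin_num_measure. Qed.

Lemma pr_ge0 (A : set Omega) : 0 <= pr A.
Proof. by rewrite fine_ge0. Qed.

(** [phi (Y o)] is a finite combination of indicators of the fibres of [Y], so measurability of the
    fibres suffices. *)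
Lemma expectation_finite (B : finType) (Y : Omega -> B) (phi : B -> R) :
  (forall b, measurable (Y @^-1` [set b])) -> (forall b, 0 <= phi b) ->
  ('E_P[fun o => phi (Y o)] = (\sum_b phi b * pr (Y @^-1` [set b]))%:E)%E.
Proof.
move=> mY phi0; rewrite unlock.
have phiE o : (phi (Y o))%:E =
    (\sum_b (phi b)%:E * (\1_(Y @^-1` [set b]) o)%:E)%E.
  rewrite (bigD1 (Y o)) //= big1 ?adde0.
    by rewrite indicE mem_set // mule1.
  by move=> b /eqP bY; rewrite indicE memNset ?mule0 // => /= /esym.
under eq_integral do rewrite phiE.
rewrite ge0_integral_sum //=.
- rewrite -sumEFin; apply: eq_bigr => b _.
  rewrite ge0_integralZl_EFin ?lee_fin //.
    by rewrite integral_indic // setIT EFinM; congr (_ * _)%E; exact: prE.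
  by apply/measurable_EFinP; exact: measurable_indic.
- move=> b; apply: emeasurable_funM => //; apply/measurable_EFinP.
  exact: measurable_indic.
- by move=> b o _; rewrite -EFinM lee_fin mulr_ge0.
Qed.

Lemma sum_pr (B : finType) (Y : Omega -> B) :
  (forall b, measurable (Y @^-1` [set b])) ->
  \sum_b pr (Y @^-1` [set b]) = 1.
Proof.
move=> mY; apply: EFin_inj.
have := expectation_finite mY (fun=> ler01).
rewrite (expectation_cst P 1).
by under [in X in _ = X -> _]eq_bigr do rewrite mul1r.
Qed.

End FiniteRandomVariables.

(** * Independence of the past and the next pair *)

Local Notation initial_segment k := [fset j in iota 0 k.+1]%fset.

Lemma in_initial_segment k i : (i \in initial_segment k) = (i <= k)%N.
Proof. by rewrite !inE mem_iota; case: i. Qed.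

Section History.
Variables (R : realType) (d : measure_display) (Omega : measurableType d).
Variables (P : probability Omega R) (A : finType) (Y : nat -> Omega -> A).
Hypothesis Y_iid : iid_discrete P Y.

Definition history k (o : Omega) : {ffun 'I_k.+1 -> A} :=
  [ffun i => Y (val i) o].

Lemma history_preimage k (s : {ffun 'I_k.+1 -> A}) :
  history k @^-1` [set s] =
  \bigcap_(i in [set` initial_segment k]) (Y i @^-1` [set s (inord i)]).
Proof.
apply/seteqP; split.
  move=> o /= <- i /=; rewrite in_initial_segment => ik.
  by rewrite ffunE /= inordK.
move=> o hist; apply/ffunP => i; rewrite ffunE.
have := hist (val i); rewrite /= inord_val; apply.
by rewrite in_initial_segment -ltnS.
Qed.

Lemma measurable_history k (s : {ffun 'I_k.+1 -> A}) :
  measurable (history k @^-1` [set s]).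
Proof.
rewrite history_preimage; apply: fin_bigcap_measurable => //.
by move=> i _; case: Y_iid.
Qed.

(** Independence over the indices up to k.+1 and over those up to k turns both sides into the same
    product. *)
Lemma history_next k (s : {ffun 'I_k.+1 -> A}) a :
  P ((fun o => (history k o, Y k.+1 o)) @^-1` [set (s, a)]) =
  (P (history k @^-1` [set s]) * P (Y k.+1 @^-1` [set a]))%E.
Proof.
pose J := initial_segment k.
(* [inord i] is meaningful only for i <= k, so index k.+1 gets its own set. *)
pose B i := if i == k.+1 then [set a] else [set s (inord i)].
have kJ : k.+1 \notin J by rewrite in_initial_segment ltnn.
have BJ i : i \in J -> B i = [set s (inord i)].
  by move=> iJ; rewrite /B; case: eqP => // ik; rewrite -ik iJ in kJ.
have -> : (fun o => (history k o, Y k.+1 o)) @^-1` [set (s, a)] =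
          \bigcap_(i in [set` (k.+1 |` J)%fset]) (Y i @^-1` B i).
  apply/seteqP; split.
    move=> o [hs ya] i /=; rewrite in_fset1U => /orP[/eqP->|iJ].
      by rewrite /B eqxx.
    rewrite BJ //.
    have : (history k @^-1` [set s]) o by [].
    by rewrite history_preimage; apply.
  move=> o hist; congr (_, _).
    suff : (history k @^-1` [set s]) o by [].
    rewrite history_preimage => i iJ; rewrite -BJ //; apply: hist.
    by rewrite /= in_fset1U iJ orbT.
  have := hist k.+1; rewrite /B eqxx /=; apply.
  by rewrite fset1U1.
case: Y_iid => _ indep _; rewrite history_preimage !indep.
rewrite big_fsetU1 //= /B eqxx muleC; congr (_ * _)%E.
apply: eq_big_seq => i iJ; congr (P (_ @^-1` _)).
exact: BJ.
Qed.

End History.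

(** * From geometric decay to the logarithmic rate *)

Lemma limn_esup_le_eventually (R : realType) (u : (\bar R)^nat) (l : \bar R) n :
  (forall k, (n <= k)%N -> (u k <= l)%E) -> (limn_esup u <= l)%E.
Proof.
move=> ul; rewrite /limn_esup /limf_esup.
apply: le_trans (_ : ereal_sup (u @` [set k | (n <= k)%N]) <= _)%E.
  apply: ereal_inf_lbound; exists [set k | (n <= k)%N] => //.
  by exists n.
by apply: ge_ereal_sup => _ [k /= nk <-]; exact: ul.
Qed.

(** The quotient is at most ln rho + ln C / k; half of the negative number ln rho absorbs ln C / k
    for large k. *)
Lemma limn_esup_log_geometric (R : realType) (e : nat -> R) (C rho : R) :
  0 < C -> 0 < rho < 1 -> (forall k, e k <= rho ^+ k * C) ->
  (limn_esup (fun k : nat => (lne (e k)%:E / k%:R%:E)%E) <= (ln rho / 2)%:E)%E.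
Proof.
move=> C0 /andP[rho0 rho1] eC.
have l0 : ln rho < 0 by apply: ln_lt0; rewrite rho0.
(* For k > n one has ln C <= k * (- ln rho / 2). *)
pose n := Num.truncn (ln C / (- ln rho / 2)).
apply: (@limn_esup_le_eventually _ _ _ n.+1) => k nk.
have k0 : 0 < k%:R :> R by rewrite ltr0n (leq_trans _ nk).
rewrite inver gt_eqF //.
(* For e k <= 0 the logarithm, hence the quotient, is -oo. *)
have [ek|ek] := leP (e k) 0.
  by rewrite le0_lneNy ?lee_fin // gt0_mulNye ?leNye // lte_fin invr_gt0.
rewrite lne_EFin // -EFinM lee_fin ler_pdivrMr //.
have h : ln (e k) <= ln rho *+ k + ln C.
  rewrite -lnXn // -lnM ?posrE ?exprn_gt0 //.
  by rewrite ler_ln ?posrE ?mulr_gt0 ?exprn_gt0.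
apply: le_trans h _; rewrite -mulr_natr.
have h2 : ln C <= k%:R * (- ln rho / 2).
  rewrite -ler_pdivrMr; last by rewrite divr_gt0 // oppr_gt0.
  by rewrite (le_trans (ltW (truncnS_gt _))) // ler_nat.
lra.
Qed.

(** * Geometric decay of the expected energy along the algorithm *)

Section ExpectedEnergy.
Variables (R : realType) (kappa : R) (M : metricType R) (N : nat).
Variable E : rel 'I_N.
Hypotheses (kappa_gt0 : 0 < kappa) (M_CAT : is_CAT kappa M).
Variables (X0 : 'I_N -> M) (d : measure_display) (Omega : measurableType d).
Variables (P : probability Omega R) (VW : nat -> Omega -> 'I_N * 'I_N).
Hypothesis VW_iid : iid_discrete P VW.

Lemma rpmS vw k : rpm X0 vw k.+1 = step (rpm X0 vw k) (vw k.+1).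
Proof. by rewrite /= /step; case: (vw k.+1). Qed.

Lemma eq_rpm vw vw' k : (forall i, (i <= k)%N -> vw i = vw' i) ->
  rpm X0 vw k = rpm X0 vw' k.
Proof.
elim: k => [//|k IHk] vwE; rewrite !rpmS vwE // IHk // => i ik.
by rewrite vwE // leqW.
Qed.

Lemma rpm_clustered vw k : clustered kappa X0 -> clustered kappa (rpm X0 vw k).
Proof.
by move=> cX0; elim: k => [//|k IHk]; rewrite rpmS; exact: step_clustered.
Qed.

(** By [eq_rpm] the k-th configuration depends only on indices up to k, where [inord] is
    faithful. *)
Definition replay k (s : {ffun 'I_k.+1 -> 'I_N * 'I_N}) : 'I_N -> M :=
  rpm X0 (fun i => s (inord i)) k.

Lemma replay_history k o : rpm X0 (VW ^~ o) k = replay (history VW k o).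
Proof. by apply: eq_rpm => i ik; rewrite ffunE /= inordK. Qed.

(** The expectation of [phi] at time k as a finite sum over histories; this asks for no measurable
    structure on [M]. *)
Definition mean_of (phi : ('I_N -> M) -> R) k : R :=
  \sum_s phi (replay s) * pr P (history VW k @^-1` [set s]).

Lemma expectation_rpm phi k : (forall x, 0 <= phi x) ->
  'E_P[fun o => phi (rpm X0 (VW ^~ o) k)]%E = (mean_of phi k)%:E.
Proof.
move=> phi0.
under [X in expectation _ X]funext do rewrite replay_history.
rewrite (@expectation_finite _ _ _ P _ _ (fun s => phi (replay s))) // => s.
exact: (measurable_history VW_iid).
Qed.

Lemma mean_of0 phi : mean_of phi 0 = phi X0.
Proof.
rewrite /mean_of /replay /= -mulr_sumr sum_pr ?mulr1 // => s.
exact: (measurable_history VW_iid).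
Qed.

(** Conditioning on the history: the pair k.+1 is independent of it and has the law of the pair
    0. *)
Lemma mean_ofS phi k : (forall x, 0 <= phi x) ->
  mean_of phi k.+1 = \sum_s pr P (history VW k @^-1` [set s]) *
    \sum_a pr P (VW 0%N @^-1` [set a]) * phi (step (replay s) a).
Proof.
move=> phi0; apply: EFin_inj; rewrite -expectation_rpm //.
under [X in expectation _ X]funext do rewrite rpmS replay_history.
have mH := measurable_history VW_iid; have [mVW _ eqVW] := VW_iid.
have mHV s a : measurable
    ((fun o => (history VW k o, VW k.+1 o)) @^-1` [set (s, a)]).
  have -> : (fun o => (history VW k o, VW k.+1 o)) @^-1` [set (s, a)] =
    history VW k @^-1` [set s] `&` VW k.+1 @^-1` [set a].
    by apply/seteqP; split => o /=; [case|case => -> ->].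
  by apply: measurableI.
rewrite (@expectation_finite _ _ _ P _ (fun o => (history VW k o, VW k.+1 o))
  (fun sa => phi (step (replay sa.1) sa.2))) //; last by case.
congr EFin; transitivity (\sum_s \sum_a phi (step (replay s) a) *
    pr P ((fun o => (history VW k o, VW k.+1 o)) @^-1` [set (s, a)])).
  by rewrite pair_bigA; apply: eq_bigr => -[].
apply: eq_bigr => s _; rewrite mulr_sumr; apply: eq_bigr => a _.
rewrite /pr history_next // fineM ?fin_num_measure // (eqVW k.+1).
by rewrite mulrC mulrA.
Qed.

Lemma mean_energy_decay rho k : 0 <= rho -> clustered kappa X0 ->
  (forall x : 'I_N -> M, clustered kappa x ->
    \sum_a pr P (VW 0%N @^-1` [set a]) * energy kappa (step x a)
      <= rho * energy kappa x) ->
  mean_of (energy kappa) k <= rho ^+ k * energy kappa X0.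
Proof.
move=> rho0 cX0 contr; elim: k => [|k IHk].
  by rewrite mean_of0 mul1r.
rewrite exprS -mulrA; apply: le_trans (ler_wpM2l rho0 IHk).
rewrite mean_ofS; last by move=> x; exact: energy_ge0.
rewrite /mean_of mulr_sumr; apply: ler_sum => s _.
rewrite mulrA [leRHS]mulrC ler_wpM2l ?pr_ge0 //.
by apply: contr; exact: rpm_clustered.
Qed.

Lemma mean_Delta_le_energy k :
  mean_of (@Delta _ _ E kappa M) k <= mean_of (energy kappa) k.
Proof.
by apply: ler_sum => s _; rewrite ler_wpM2r ?pr_ge0 ?Delta_le_energy.
Qed.

(** The law gives the unordered edge mass at least N^-1 / deg v, and deg v <= N. *)
Lemma edge_mass v w : irreflexive E -> edge_law P E (VW 0%N) -> E v w ->
  N%:R^-1 ^+ 2 <= pr P (VW 0%N @^-1` [set (v, w)]) +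
                  pr P (VW 0%N @^-1` [set (w, v)]).
Proof.
move=> irrE law vw; have [mVW _ _] := VW_iid.
have N0 : (0 < N)%N := leq_ltn_trans (leq0n v) (ltn_ord v).
rewrite -lee_fin EFinD -!prE //.
rewrite -measureU //; last 1 first.
  apply/seteqP; split => // o [/= -> [wv _]].
  by rewrite wv irrE in vw.
(* Since v and w differ, {a, b} = {v, w} leaves only the two orderings. *)
have setE : VW 0%N @^-1` [set (v, w)] `|` VW 0%N @^-1` [set (w, v)] =
    [set o | [set (VW 0%N o).1; (VW 0%N o).2] = [set v; w]].
  apply/seteqP; split=> o /=; first by case=> -> //=; rewrite setUC.
  case: (VW 0%N o) => a b /= abvw.
  have va : [set a; b] v by rewrite abvw; left.
  have wa : [set a; b] w by rewrite abvw; right.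
  case: va wa vw => /= -> [] /= ->; rewrite ?irrE // => _; [by left|by right].
have := law v w; rewrite vw -setE => lawvw.
apply: le_trans (_ : (N%:R^-1 * ((deg E v)%:R^-1 + (deg E w)%:R^-1))%:E <= _)%E;
  last by rewrite -lawvw.
rewrite lee_fin expr2 ler_wpM2l ?invr_ge0 //.
have degw : 0 <= (deg E w)%:R^-1 :> R by rewrite invr_ge0.
apply: le_trans (_ : (deg E v)%:R^-1 <= _); last by rewrite lerDl.
have dv : (0 < deg E v)%N by apply/card_gt0P; exists w.
rewrite lef_pV2 ?posrE ?ltr0n // ler_nat /deg.
by have := max_card [pred w | E v w]; rewrite card_ord.
Qed.

End ExpectedEnergy.

(** * Exponential decay of the expected disagreement *)

Theorem theorem4 (R : realType) (kappa : R) (N : nat) (E : rel 'I_N)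
    (M : metricType R) (X0 : 'I_N -> M)
    (d : measure_display) (Omega : measurableType d) (P : probability Omega R)
    (VW : nat -> Omega -> 'I_N * 'I_N)
    (kappa_gt0 : 0 < kappa)
    (N_ge2 : (2 <= N)%N)
    (E_sym : symmetric E) (E_irr : irreflexive E)
    (E_conn : forall v w : 'I_N, connect E v w)
    (M_complete : metric_complete M)
    (M_CAT : is_CAT kappa M)
    (X0_diam : (diam (range X0) < (r_ kappa)%:E)%E)
    (VW_iid : iid_discrete P VW)
    (VW_law : forall k, edge_law P E (VW k)) :
  exists L : R, L < 0 /\
    (limn_esup (fun k : nat =>
       lne 'E_P[fun o => Delta E kappa (rpm X0 (VW ^~ o) k)] / k%:R%:E)
     <= L%:E)%E.
Proof.
have N0 : (0 < N)%N by exact: ltnW.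
have cX0 : clustered kappa X0.
  move=> u t; rewrite near_ptsE // -lte_fin; apply: le_lt_trans X0_diam.
  apply: ereal_sup_ubound; exists (X0 u); first by exists u.
  by exists (X0 t) => //; exists t.
have [mVW _ _] := VW_iid.
have [rho rhoI contr] : exists2 rho, 0 < rho < 1 &
    forall x : 'I_N -> M, clustered kappa x ->
      \sum_a pr P (VW 0%N @^-1` [set a]) * energy kappa (step x a)
        <= rho * energy kappa x.
  apply: (@energy_contraction _ _ M _ E kappa_gt0 M_CAT (N%:R^-1 ^+ 2)) => //.
  - by rewrite exprn_gt0 // invr_gt0 ltr0n.
  - by move=> a; exact: pr_ge0.
  - by apply: sum_pr => a; exact: mVW.
  - by move=> v w; apply: edge_mass.
have /andP[rho0 rho1] := rhoI.
exists (ln rho / 2); split.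
  by rewrite pmulr_llt0 ?invr_gt0 // ln_lt0.
have D0 (x : 'I_N -> M) : 0 <= Delta E kappa x by exact: Delta_ge0.
under [X in limn_esup X]funext do rewrite (expectation_rpm _ VW_iid _ D0).
(* The added 1 keeps the constant positive when the initial energy is 0. *)
apply: (@limn_esup_log_geometric _ _ (energy kappa X0 + 1)) => // [|k].
  by rewrite ltr_wpDl // energy_ge0.
apply: le_trans; first exact: mean_Delta_le_energy.
apply: le_trans; first exact: (mean_energy_decay _ _ _ _ (ltW rho0) cX0 contr).
by rewrite ler_wpM2l ?exprn_ge0 ?lerDl // ltW.
Qed.
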